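(* For integers $p\ge 2$ and $n\ge 1$, \[ \sum_{k=1}^n\bar H_k^p=(n+1)\bar H_n^p-\frac{p}2(-1)^n\bar H_n^{p-1}+\sum_{(a_1,\dots,a_k)\vDash p-1} c_{(a_1,\dots,a_k)}^{(p)}\,\zeta_n(\overline{\alpha_1},\alpha_2,\dots,\alpha_k), \] where the right-hand sum is over all compositions $(a_1,\dots,a_k)$ of $p-1$ (of any length $k$), \[ \alpha_i=\begin{cases} a_i,&\text{if $a_i$ is even;}\\ \overline{a_i},&\text{if $a_i$ is odd;}\end{cases} \qquad\text{and}\qquad c_{(a_1,\dots,a_k)}^{(p)}=\frac{p!\,(a_1-1)}{2\,(a_1+1)!\,a_2!\cdots a_k!} . \]
   Context: Arguments of truncated multiple zeta values may be integers $a$ or barred integers $\bar a$. For such arguments, $\zeta_n(a_1,\dots,a_k)=\sum_{n\ge n_1>\dots>n_k\ge1}\prod_{i=1}^k f_{a_i}(n_i)$, where $f_a(m)=m^{-a}$ for an unbarred integer $a$ and $f_{\bar a}(m)=(-1)^m m^{-a}$ for a barred one (an empty sum is $0$). For example $\zeta_n(\bar2,1)=\sum_{n\ge k>l\ge1}\frac{(-1)^k}{k^2l}$. The bar operation toggles: $\overline{\bar a}=a$. $\bar H_n=\zeta_n(\bar1)=\sum_{i=1}^n\frac{(-1)^i}{i}$, and $\bar H_n^p=(\bar H_n)^p$. A composition of $m$ is an ordered tuple of positive integers with sum $m$. *)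

(* Defs.v *)
From HB Require Import structures.
From mathcomp Require Import all_boot all_order all_algebra.

Set Implicit Arguments.
Unset Strict Implicit.
Unset Printing Implicit Defensive.

Import Order.TTheory GRing.Theory Num.Theory.

Local Open Scope ring_scope.

Inductive zarg : Type := Plain of int | Barred of int.

Definition bar (a : zarg) : zarg :=
  match a with Plain z => Barred z | Barred z => Plain z end.

Definition zfactor (a : zarg) (m : nat) : rat :=
  match a with
  | Plain z => m%:R ^ (- z)
  | Barred z => (-1) ^+ m * m%:R ^ (- z)
  end.

(* A tuple t over 'I_n.+1 that is strictly decreasing with positive entries is
   exactly a choice of indices n >= n_1 > ... > n_k >= 1. The default value of
   nth is never reached. *)
Definition zeta (n : nat) (a : seq zarg) : rat :=
  \sum_(t : (size a).-tuple 'I_n.+1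
          | sorted gtn (map val t) && all (leq 1%N) (map val t))
    \prod_(i < size a) zfactor (nth (Plain 0) a i) (tnth t i).

Definition Hbar (n : nat) : rat := zeta n [:: Barred 1].

Definition is_composition (m : nat) (a : seq nat) : bool :=
  all (leq 1%N) a && (sumn a == m).

(* A composition of m has at most m parts, each at most m;
   see mem_compositions and compositions_uniq. *)
Definition compositions (m : nat) : seq (seq nat) :=
  [seq a <- [seq map val (val t) | k <- iota 0 m.+1, t <- enum {: k.-tuple 'I_m.+1}]
  | is_composition m a].

Lemma mem_compositions (m : nat) (a : seq nat) :
  (a \in compositions m) = is_composition m a.
Proof.
rewrite mem_filter andbC; case: (boolP (is_composition m a)); last by rewrite andbF.
rewrite andbT => /andP[a_gt0 /eqP sum_a].
have size_a : (size a <= m)%N.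
  rewrite -sum_a; elim: a a_gt0 {sum_a} => //= x a IHa /andP[x_gt0 /IHa le_a].
  by rewrite -add1n leq_add.
have le_a : all (fun x => x < m.+1)%N a.
  apply/allP => x x_a; rewrite ltnS -sum_a.
  elim: a x_a {a_gt0 sum_a size_a} => //= y a IHa; rewrite inE.
  case/orP => [/eqP <-|/IHa]; first exact: leq_addr.
  by move/leq_trans; apply; apply: leq_addl.
have size_t : size (map (@inord m) a) == size a by rewrite size_map.
apply/allpairsPdep; exists (size a), (Tuple size_t); split.
- by rewrite mem_iota.
- by rewrite mem_enum.
rewrite /= -map_comp; rewrite -[LHS]map_id; apply/eq_in_map => x x_a /=.
by rewrite inordK //; apply: (allP le_a).
Qed.

Lemma compositions_uniq (m : nat) : uniq (compositions m).
Proof.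
apply: filter_uniq; apply: allpairs_uniq_dep.
- exact: iota_uniq.
- by move=> k _; apply: enum_uniq.
move=> [k t] [l u] _ _ /= eq_tu.
have eq_kl : k = l.
  by rewrite -(size_tuple t) -(size_tuple u) -(size_map val t) eq_tu size_map.
case: l / eq_kl u eq_tu => u /(inj_map val_inj) eq_tu.
by congr existT; apply: val_inj.
Qed.

Definition alpha (a : nat) : zarg :=
  if odd a then Barred a%:Z else Plain a%:Z.

Definition bar_head (s : seq zarg) : seq zarg :=
  if s is x :: s' then bar x :: s' else [::].

(* Only used on nonempty compositions, for which head 0 a is a_1. *)
Definition coef (p : nat) (a : seq nat) : rat :=
  (p`!%:R * ((head 0%N a)%:R - 1))
    / (2 * (head 0%N a).+1`!%:R * \prod_(b <- behead a) b`!%:R).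

(* Main.v *)
Require Import Defs.
From mathcomp Require Import all_boot all_order all_algebra.
From mathcomp Require Import ring.

Import Order.TTheory GRing.Theory Num.Theory.

Local Open Scope ring_scope.

(** Write [H m] for [Hbar m], [eps m] for [(-1)^m], [x m = eps m / m] and
    [y^[k] = y^k / k!] for the divided powers.

    The composition sum on the right is a telescoping device. Peeling off the
    largest index [n_1 = m] of the truncated zeta values gives
    [zeta m (a :: s) - zeta (m-1) (a :: s) = f_a(m) * zeta (m-1) s]
    ([zetaS_cons]). The parity rule defining [alpha] is exactly what makes
    [f_(alpha a) m = (x m)^a] for every [a], so expanding [(H (m-1) + x m)^[q]]
    by the binomial theorem shows, by induction on [m], that the generating
    sums over compositions are powers of [H] ([dpow_Hbar]):
    [(H m)^[q] = sum over (a_1..a_k) |= q of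
       zeta m (alpha a_1 .. alpha a_k) / (a_1! .. a_k!)].

    Hence the increment at [m] of the composition sum in the theorem only
    involves [h = H (m-1)] and [x = x m]: it is
    [p! * eps m * (sum over j < p - 1 of j x^(j+1) h^[p-2-j] / (2 (j+2)!))]
    ([sum_coef_zetaS], with [a_1 = j+1]).

    On the other side, summation by parts reduces the theorem to computing
    [m * ((H m)^p - (H (m-1))^p)], and [m = eps m / x m], so what is needed is
    the difference quotient [((h+x)^[p] - h^[p]) / x]. It is the mean value of
    [y^[p-1]] on the segment from [h] to [h+x]; the trapezoid rule approximates
    it by [((h+x)^[p-1] + h^[p-1]) / 2], whose contributions telescope to the
    term in [H n ^ (p-1)] because [eps] alternates. The Taylor expansion of the
    error of the rule ([trapezoid_error]) is the sum over [j] above, so the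
    coefficients [(a_1 - 1) / (2 (a_1 + 1)!)] of the theorem are the Taylor
    coefficients of the trapezoid error. The proof carries out this comparison
    as an induction on [n]. *)

(** * Truncated zeta values as nested sums *)

(** The bound [b] is strict, so that the index just chosen bounds the next
    one. *)
Fixpoint nested_sum (s : seq zarg) (b : nat) : rat :=
  if s is a :: s' then \sum_(1 <= x < b) zfactor a x * nested_sum s' x else 1.

Lemma sum_tuple_cons (T : finType) (k : nat) (P : pred (seq T))
    (F : seq T -> rat) :
  \sum_(t : k.+1.-tuple T | P t) F t =
  \sum_(x : T) \sum_(t : k.-tuple T | P (x :: t)) F (x :: t).
Proof.
rewrite pair_big_dep /=.
rewrite (reindex (fun u : T * k.-tuple T => [tuple of u.1 :: u.2])) //=.
exists (fun t => (thead t, [tuple of behead t])) => [[x t] _|t _] /=.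
- by congr pair; apply: val_inj.
- by rewrite [RHS]tuple_eta; apply: val_inj.
Qed.

(** The range ['I_n.+1] of the tuples stays fixed along the induction while the
    bound [b] on the head shrinks; separating the two avoids any change of
    index type when the head is removed. *)
Lemma sum_decreasing_tuples (n : nat) (s : seq zarg) (b : nat) :
  (b <= n.+1)%N ->
  \sum_(t : (size s).-tuple 'I_n.+1
          | path gtn b (map val t) && all (leq 1%N) (map val t))
    \prod_(i < size s) zfactor (nth (Plain 0) s i) (nth ord0 t i)
  = nested_sum s b.
Proof.
elim: s b => [|a s IHs] b le_b /=.
  rewrite (big_pred1 [tuple]) ?big_ord0 // => t.
  by rewrite (tuple0 t) /= eqxx.
rewrite (sum_tuple_cons _ _
  (fun t => path gtn b (map val t) && all (leq 1%N) (map val t))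
  (fun t => \prod_(i < (size s).+1)
              zfactor (nth (Plain 0) (a :: s) i) (nth ord0 t i))) /=.
transitivity (\sum_(x < n.+1 | (x < b)%N && (0 < x)%N)
                 zfactor a x * nested_sum s x).
  rewrite [RHS]big_mkcond /=; apply: eq_bigr => x _.
  case: ifP => x_ok; last first.
    rewrite big_pred0 // => t; apply: contraFF x_ok.
    by case/andP=> /andP[-> _] /andP[-> _].
  have /andP[x_lt x_gt] := x_ok.
  rewrite -IHs; last exact: ltnW.
  rewrite big_distrr /=; apply: eq_big => [t|t _].
    by rewrite x_lt x_gt.
  by rewrite big_ord_recl.
rewrite -(big_mkord (fun x => (x < b)%N && (0 < x)%N)
            (fun x => zfactor a x * nested_sum s x)).
rewrite (big_nat_widenl 1 0) // [RHS](big_nat_widen _ _ n.+1) //.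
by apply: eq_bigl => x /=; rewrite andbC.
Qed.

Lemma zeta_nested (n : nat) (s : seq zarg) : zeta n s = nested_sum s n.+1.
Proof.
rewrite -(sum_decreasing_tuples n s n.+1) // /zeta.
apply: eq_big => [t|t _]; last first.
  by apply: eq_bigr => i _; rewrite (tnth_nth ord0).
by case: t => -[|x t] //= _; rewrite ltn_ord.
Qed.

Lemma zeta_nil (n : nat) : zeta n [::] = 1.
Proof. by rewrite zeta_nested. Qed.

Lemma zeta0_cons (a : zarg) (s : seq zarg) : zeta 0 (a :: s) = 0.
Proof. by rewrite zeta_nested /= big_geq. Qed.

(** The chains new at [n.+1] are those whose largest index is [n.+1]. *)
Lemma zetaS_cons (n : nat) (a : zarg) (s : seq zarg) :
  zeta n.+1 (a :: s) = zeta n (a :: s) + zfactor a n.+1 * zeta n s.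
Proof. by rewrite !zeta_nested /= big_nat_recr. Qed.

(** * The factors attached to parity-barred arguments *)

Definition altinv (m : nat) : rat := (-1) ^+ m / m%:R.

(** For odd [a] the sign [(-1)^m] of the barred factor is [((-1)^m)^a]; for even
    [a] that power is [1], and [alpha a] carries no bar. *)
Lemma zfactor_alpha (a m : nat) : zfactor (alpha a) m = altinv m ^+ a.
Proof.
rewrite /alpha /altinv exprMn -exprM mulnC exprM -signr_odd exprVn.
by case: ifP => odd_a /=; rewrite -exprnN ?expr1 // expr0 expr1n mul1r.
Qed.

(** Toggling a bar multiplies by [(-1)^m], in either direction. *)
Lemma zfactor_bar_alpha (a m : nat) :
  zfactor (bar (alpha a)) m = (-1) ^+ m * altinv m ^+ a.
Proof.
rewrite -zfactor_alpha /alpha; case: ifP => //= _.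
by rewrite mulrA -expr2 sqrr_sign mul1r.
Qed.

Lemma Hbar0 : Hbar 0 = 0.
Proof. exact: zeta0_cons. Qed.

Lemma HbarS (n : nat) : Hbar n.+1 = Hbar n + altinv n.+1.
Proof.
by rewrite /Hbar zetaS_cons zeta_nil mulr1 (zfactor_alpha 1) expr1.
Qed.

(** * Compositions by their first part *)

Lemma perm_compositions0 : perm_eq (compositions 0) [:: [::]].
Proof.
apply: uniq_perm; rewrite ?compositions_uniq // => a.
by rewrite mem_compositions inE; case: a => [|[|x] a] //; apply: andbF.
Qed.

Lemma perm_compositionsS (q : nat) :
  perm_eq (compositions q.+1)
    [seq j.+1 :: b | j <- iota 0 q.+1, b <- compositions (q - j)].
Proof.
apply: uniq_perm; first exact: compositions_uniq.
  apply: allpairs_uniq_dep; first exact: iota_uniq.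
    by move=> j _; apply: compositions_uniq.
  by move=> [j b] [k c] _ _ /= [-> ->].
move=> a; rewrite mem_compositions; apply/idP/allpairsPdep.
  case: a => [|[|j] b] // /andP[b_gt0]; rewrite -[sumn _]/(j.+1 + sumn b)%N.
  rewrite addSn eqSS => /eqP sum_b; exists j, b.
  rewrite mem_iota mem_compositions /is_composition (b_gt0 : all (leq 1) b).
  by rewrite -sum_b addKn add0n ltnS leq_addr eqxx.
case=> j [b [+ + ->]]; rewrite mem_iota mem_compositions add0n ltnS /=.
move=> le_j /andP[b_gt0 /eqP sum_b].
by rewrite /is_composition /= b_gt0 sum_b addSn subnKC ?eqxx.
Qed.

Lemma sum_compositionsS (q : nat) (F : seq nat -> rat) :
  \sum_(a <- compositions q.+1) F a =
  \sum_(j < q.+1) \sum_(b <- compositions (q - j)) F (j.+1 :: b).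
Proof.
rewrite (perm_big _ (perm_compositionsS q)) big_allpairs_dep.
rewrite -(big_mkord xpredT
            (fun j => \sum_(b <- compositions (q - j)) F (j.+1 :: b))).
by rewrite /index_iota subn0.
Qed.

(** * Divided powers of the alternating harmonic sums *)

(** With divided powers the binomial theorem is a plain convolution and the
    factors [1 / a_i!] of the coefficients appear one per part. *)
Definition dpow (x : rat) (k : nat) : rat := x ^+ k / k`!%:R.

Lemma fact_neq0 (k : nat) : k`!%:R != 0 :> rat.
Proof. by rewrite pnatr_eq0 -lt0n fact_gt0. Qed.

Lemma dpow0 (x : rat) : dpow x 0 = 1.
Proof. by rewrite /dpow expr0 divr1. Qed.

Lemma dpowD (h x : rat) (q : nat) :
  dpow (h + x) q = \sum_(j < q.+1) dpow x j * dpow h (q - j).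
Proof.
rewrite {1}/dpow exprDn mulr_suml; apply: eq_bigr => j _.
have le_j : (j <= q)%N by rewrite -ltnS.
rewrite -(bin_fact le_j) !natrM /dpow -mulr_natr.
have := fact_neq0 j; have := fact_neq0 (q - j).
have : 'C(q, j)%:R != 0 :> rat by rewrite pnatr_eq0 -lt0n bin_gt0.
move=> C0 d0 j0; field; by rewrite C0 d0 j0.
Qed.

(** In the expansion of [(Hbar n + altinv n.+1)^q], the term of exponent [0] in
    [altinv n.+1] collects the chains below [n.+1], and the term of exponent
    [j.+1] the compositions whose first part [j.+1] is carried by the index
    [n.+1]. *)
Lemma dpow_Hbar (n q : nat) :
  dpow (Hbar n) q =
  \sum_(a <- compositions q)
     (\prod_(b <- a) b`!%:R)^-1 * zeta n (map alpha a).
Proof.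
elim: n q => [|n IHn] [|q].
- rewrite (perm_big _ perm_compositions0) big_seq1 big_nil zeta_nil dpow0.
  by rewrite invr1 mulr1.
- rewrite Hbar0 sum_compositionsS /dpow expr0n mul0r big1 // => j _.
  by rewrite big1 // => b _; rewrite zeta0_cons mulr0.
- rewrite (perm_big _ perm_compositions0) big_seq1 big_nil zeta_nil dpow0.
  by rewrite invr1 mulr1.
rewrite HbarS dpowD big_ord_recl dpow0 mul1r subn0 IHn.
rewrite !sum_compositionsS -big_split; apply: eq_bigr => j _ /=.
rewrite subSS IHn big_distrr -big_split; apply: eq_bigr => b _ /=.
rewrite zetaS_cons zfactor_alpha mulrDr; congr (_ + _).
rewrite big_cons invfM /dpow; ring.
Qed.

(** * The increment identity *)

(** The left-hand side is the mean of [dpow _ q] over the segment from [h] to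
    [h + x]. The coefficient of [x ^+ j.+1] in the error of the trapezoid rule
    is [1 / (2 (j+1)!) - 1 / (j+2)! = j / (2 (j+2)!)]. *)
Lemma trapezoid_error (h x : rat) (q : nat) : x != 0 ->
  (dpow (h + x) q.+1 - dpow h q.+1) / x =
  (dpow (h + x) q + dpow h q) / 2
  - \sum_(j < q) j%:R / (2 * j.+2`!%:R) * x ^+ j.+1 * dpow h (q - j.+1).
Proof.
move=> x0.
rewrite !dpowD big_ord_recl dpow0 mul1r subn0 addrC addKr.
rewrite !big_ord_recl /= dpow0 mul1r !subn0.
have -> : dpow x 1 = x by rewrite /dpow divr1.
rewrite subn1 /= mulrDl mulrAC divff // mul1r !mulr_suml.
set S0 := \sum_(j < q) _ / x.
set S1 := \sum_(j < q) dpow x _ * _.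
set S2 := \sum_(j < q) _ / _ * _ * _.
(* The constant terms in [x] agree; compare the coefficients of [x ^+ j.+1]. *)
suff -> : S0 = S1 / 2 - S2 by field.
rewrite /S0 /S1 /S2 mulr_suml -sumrB; apply: eq_bigr => j _.
rewrite /bump /= !add1n subSS /dpow !factS !natrM exprS -!natr1.
have := fact_neq0 j; have := fact_neq0 (q - j.+1).
have : j%:R + 1 != 0 :> rat by rewrite natr1 pnatr_eq0.
have : j%:R + 1 + 1 != 0 :> rat by rewrite !natr1 pnatr_eq0.
move=> a b c d; field; by rewrite ?a ?b ?c ?d ?x0.
Qed.

(** Removing the first part [j.+1] leaves an unrestricted composition of
    [q - j], over which [dpow_Hbar] sums the remaining factors. *)
Lemma sum_coef_zetaS (q m : nat) :
  \sum_(a <- compositions q.+1)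
     coef q.+2 a * zeta m.+1 (bar_head (map alpha a))
  = \sum_(a <- compositions q.+1)
       coef q.+2 a * zeta m (bar_head (map alpha a))
    + (-1) ^+ m.+1 * q.+2`!%:R *
      \sum_(j < q.+1) j%:R / (2 * j.+2`!%:R) * altinv m.+1 ^+ j.+1
                      * dpow (Hbar m) (q.+1 - j.+1).
Proof.
rewrite !sum_compositionsS big_distrr -big_split; apply: eq_bigr => j _ /=.
rewrite subSS dpow_Hbar !big_distrr -big_split; apply: eq_bigr => b _ /=.
rewrite zetaS_cons mulrDr zfactor_bar_alpha; congr (_ + _).
rewrite /coef /= !invfM -natr1 addrK; ring.
Qed.

Theorem theorem6p2 (p n : nat) (hp : (2 <= p)%N) (hn : (1 <= n)%N) :
  \sum_(1 <= k < n.+1) Hbar k ^+ p =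
    (n%:R + 1) * Hbar n ^+ p
    - p%:R / 2 * (-1) ^+ n * Hbar n ^+ (p - 1)
    + \sum_(a <- compositions (p - 1))
        coef p a * zeta n (bar_head (map alpha a)).
Proof.
case: p hp => [|[|q]] // _; rewrite subn1 /=.
elim: n {hn} => [|m IHm].
  rewrite big_geq // Hbar0 !expr0n /= !mulr0 subr0 add0r sum_compositionsS.
  by rewrite big1 // => j _; rewrite big1 // => b _; rewrite zeta0_cons mulr0.
rewrite big_nat_recr //= IHm sum_coef_zetaS.
have m0 : m.+1%:R != 0 :> rat by rewrite pnatr_eq0.
have x0 : altinv m.+1 != 0 by rewrite mulf_neq0 ?signr_eq0 ?invr_eq0.
have := trapezoid_error (Hbar m) _ q.+1 x0; rewrite -HbarS.
have -> : (altinv m.+1)^-1 = (-1) ^+ m.+1 * m.+1%:R.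
  by rewrite /altinv invf_div mulrC invr_sign.
set S := \sum_(j < q.+1) _ => trapezoid.
(* Solved for [(-1) ^+ m.+1 * S], the form in which [S] occurs in the goal,
   the error formula has the integer factor [m.+1]. *)
have signS : (-1) ^+ m.+1 * S =
    (-1) ^+ m.+1 * ((dpow (Hbar m.+1) q.+1 + dpow (Hbar m) q.+1) / 2)
    - (dpow (Hbar m.+1) q.+2 - dpow (Hbar m) q.+2) * m.+1%:R.
  rewrite -[S](subKr ((dpow (Hbar m.+1) q.+1 + dpow (Hbar m) q.+1) / 2)).
  rewrite -trapezoid mulrBr; congr (_ - _).
  by rewrite mulrCA (mulrA ((-1) ^+ _)) -expr2 sqrr_sign mul1r.
have f0 := fact_neq0 q.+1.
rewrite (mulrAC _ _ S) signS /dpow [q.+2`!]factS natrM (exprS _ m).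
by field; rewrite f0 -natrD pnatr_eq0.
Qed.
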